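(* There exist positive constants $M_6$ and $M_7$ that are independent of the sampling point $\tau$ such that $$\left|I(\tau)-I^{\delta}(\tau)\right|\leq M_{6}\,\|u^{\delta}(x,z)-u(x,z)\|^{2}_{L^{\infty}(\partial B\times\Sigma)}+M_{7}\,\|u^{\delta}(x,z)-u(x,z)\|_{L^{\infty}(\partial B\times\Sigma)},$$ where $I^{\delta}(\tau)$ is the indicator functional $I(\tau)$ with $u(x_j,z_l)$ and $u(x_m,z_l)$ replaced by $u^{\delta}(x_j,z_l)$ and $u^{\delta}(x_m,z_l)$.
   Context: Scattering problem. $D\subset\mathbb{R}^2$ is a bounded simply connected sound-soft obstacle with $C^2$ boundary $\partial D$, and $k>0$ is the wave number. $\phi(x,y)=\frac{\mathrm{i}}{4}H_0^{(1)}(k|x-y|)$ is the outgoing fundamental solution of the Helmholtz equation in $\mathbb{R}^2$, where $H_0^{(1)}$ is the Hankel function of the first kind of order zero. For a point source at $z\in\mathbb{R}^2\setminus\overline{D}$, the incident field is $u^i(x,z)=\phi(x,z)$. The scattered field $u^s(\cdot,z)$ is the solution of $\Delta u^s+k^2u^s=0$ in $\mathbb{R}^2\setminus\overline{D}$ with $u^s=-u^i$ on $\partial D$, satisfying the Sommerfeld radiation condition $\lim_{r=|x|\to\infty}\sqrt{r}\,(\partial u^s/\partial r-\mathrm{i}ku^s)=0$ uniformly in all directions. The total field is $u=u^i+u^s$, and $u^{\delta}$ denotes a noisy version of the total field. Geometry. $\partial B$ is a circle of radius $r_B$ that contains $D$ in its interior; the measurement points $x_1,\dots,x_J$ lie on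 $\partial B$. $\Sigma$ is the incident curve, which encloses $\partial B$, and $|\Sigma|$ is its measure (length). The positions $z_1,\dots,z_L$ of the incident point sources are randomly distributed on $\Sigma$ and are far away from $D$. $\Omega$ is a sampling domain that contains $D$. The sampling point $\tau\in\Omega$ is contained inside $\partial B$. Cross-correlation and indicator. For $1\le j,m\le J$, $$C_{jm}=\frac{2\mathrm{i}k|\Sigma|}{L}\sum_{l=1}^{L}\overline{u(x_j,z_l)}\,u(x_m,z_l)-\big[\phi(x_j,x_m)-\overline{\phi(x_j,x_m)}\big],$$ where for $j=m$ the bracket is read as its continuous extension (the difference $\phi-\overline{\phi}=2\mathrm{i}\,\mathrm{Im}\,\phi$ has no singularity). The indicator functional is $$I(\tau)=-k^{2}\,\mathrm{Im}\left\{\frac{(2\pi)^2r_B^2}{J^2}\sum_{m=1}^{J}\sum_{j=1}^{J}\phi(\tau,x_m)\,\phi(\tau,x_j)\,\overline{C_{jm}}\right\}.$$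
   Formalization: The closure of the sampling domain Ω is assumed to lie strictly inside ∂B (if τ may approach a measurement point, φ(τ,x_m) blows up and the bound fails), and the L^∞ norm is read as the pointwise supremum over ∂B×Σ, since the indicator samples point values. *)

(* Defs.v *)
From HB Require Import structures.
From mathcomp Require Import all_boot all_order all_algebra.
From mathcomp Require Import all_classical all_reals all_analysis.
From mathcomp Require Import complex.

Set Implicit Arguments.
Unset Strict Implicit.
Unset Printing Implicit Defensive.

Import Order.TTheory GRing.Theory Num.Theory.
Import numFieldNormedType.Exports.

Local Open Scope classical_set_scope.
Local Open Scope ring_scope.
Local Open Scope complex_scope.

Notation plane R := ('rV[R]_2).

Section Plane.
Context {R : realType}.
Implicit Types (D U : set (plane R)) (x v c : plane R).

(* The library norm on row vectors is the sup norm.  Only its topology and its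
   bounded sets are used below, and these are the Euclidean ones. *)
Definition enorm x : R := Num.sqrt (\sum_(i < 2) x 0 i ^+ 2).

Definition basis (i : 'I_2) : plane R := delta_mx 0 i.

Definition boundary D : set (plane R) := closure D `\` D°.

Definition circle c (r : R) : set (plane R) := [set x | enorm (x - c) = r].

Definition open_disc c (r : R) : set (plane R) := [set x | enorm (x - c) < r].

(* Every loop in D is contractible in D with fixed base point. *)
Definition simply_connected D : Prop :=
  connected D /\
  forall g : R -> plane R,
    {within `[0, 1], continuous g} -> g @` `[0, 1] `<=` D -> g 0 = g 1 ->
    exists H : R * R -> plane R,
      [/\ {within `[0, 1] `*` `[0, 1], continuous H},
          H @` (`[0, 1] `*` `[0, 1]) `<=` D,
          forall t : R, 0 <= t <= 1 -> H (0, t) = g t,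
          forall t : R, 0 <= t <= 1 -> H (1, t) = g 0 &
          forall s : R, 0 <= s <= 1 -> H (s, 0) = g 0 /\ H (s, 1) = g 0].

(* Near each boundary point, D is one side of the graph of a C^2 function, up to
   exchanging and reflecting the coordinate axes. *)
Definition C2_boundary D : Prop :=
  forall p, boundary D p ->
    exists r : R, exists g : R -> R, exists i j : 'I_2, exists b : bool,
      [/\ 0 < r, i != j,
          [/\ forall t : R, derivable g t 1,
              forall t : R, derivable (derive1 g) t 1 &
              continuous (derive1 (derive1 g))] &
          forall x, enorm (x - p) < r ->
            (D x <-> 0 < (-1) ^+ b * (x 0 j - g (x 0 i)))].

Definition obstacle D : Prop :=
  [/\ D !=set0, open D, bounded_set D, simply_connected D & C2_boundary D].

(* Closed Jordan curve parametrised by [0, 1]. *)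
Definition jordan_curve (s : R -> plane R) : Prop :=
  [/\ {within `[0, 1], continuous s}, s 0 = s 1 &
      forall t t' : R, 0 <= t < 1 -> 0 <= t' < 1 -> s t = s t' -> t = t'].

Definition curve_image (s : R -> plane R) : set (plane R) := s @` `[0, 1].

Definition polygon_length (s : R -> plane R) (p : seq R) : R :=
  \sum_(0 <= n < size p)
    enorm (s (nth 1 (0 :: p) n.+1) - s (nth 1 (0 :: p) n)).

Definition polygon_lengths (s : R -> plane R) : set R :=
  [set polygon_length s p | p in itv_partition 0 1].

Definition rectifiable (s : R -> plane R) : Prop :=
  has_ubound (polygon_lengths s).

Definition curve_length (s : R -> plane R) : R := sup (polygon_lengths s).

(* A lies in the union of the bounded components of the complement of S. *)
Definition encloses (S A : set (plane R)) : Prop :=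
  forall x, A x -> ~ S x /\ bounded_set (connected_component (~` S) x).

End Plane.

Section Bessel.
Context {R : realType}.
Implicit Type t : R.

(* series harmonic n = 1 + 1/2 + ... + 1/n *)
Definition euler_gamma : R :=
  limn (fun n => series harmonic n - ln (n%:R : R)).

Definition besselJ0 t : R :=
  limn (series (fun n => (-1) ^+ n * (t / 2) ^+ n.*2 / n`!%:R ^+ 2)).

Definition besselY0 t : R :=
  2 / pi * ((ln (t / 2) + euler_gamma) * besselJ0 t
    - limn (series (fun n =>
        (-1) ^+ n * series harmonic n * (t / 2) ^+ n.*2 / n`!%:R ^+ 2))).

Definition hankel0 t : R[i] := besselJ0 t +i* besselY0 t.

End Bessel.

Section Scattering.
Context {R : realType}.
Implicit Types (D : set (plane R)) (k : R) (x y z : plane R).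
Implicit Types (f : plane R -> R[i]) (u : plane R -> plane R -> R[i]).

Definition phi k x y : R[i] := 'i / 4 * hankel0 (k * enorm (x - y)).

Definition cderive f (v : plane R) x : R[i] :=
  'D_v (fun y => complex.Re (f y)) x +i* 'D_v (fun y => complex.Im (f y)) x.

Definition laplacian f x : R[i] :=
  \sum_(i < 2) cderive (cderive f (basis i)) (basis i) x.

Definition C2_on (U : set (plane R)) (h : plane R -> R) : Prop :=
  forall x, U x -> forall i j : 'I_2,
    [/\ derivable h x (basis i),
        derivable ('D_(basis i) h) x (basis j) &
        {for x, continuous ('D_(basis j) ('D_(basis i) h))}].

(* sqrt(r) (df/dr - i k f) -> 0 as r = |x| -> oo, uniformly in x / |x| *)
Definition sommerfeld k f : Prop :=
  forall e : R, 0 < e -> exists rho : R, forall x, rho <= enorm x ->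
    Normc.normc ((Num.sqrt (enorm x))%:C *
      (cderive f ((enorm x)^-1 *: x) x - 'i * k%:C * f x)) < e.

Definition scattered_field D k z f : Prop :=
  [/\ C2_on (~` closure D) (fun x => complex.Re (f x)) /\
      C2_on (~` closure D) (fun x => complex.Im (f x)),
      {within ~` D, continuous (fun x => complex.Re (f x))} /\
      {within ~` D, continuous (fun x => complex.Im (f x))},
      forall x, ~ closure D x -> laplacian f x + (k ^+ 2)%:C * f x = 0,
      forall x, boundary D x -> f x = - phi k x z &
      sommerfeld k f].

Definition total_field k u x z : R[i] := phi k x z + u x z.

(* phi(x, y) - conj(phi(x, y)) = 2 i Im phi(x, y), extended continuously to
   x = y. *)
Definition phi_jump k x y : R[i] :=
  if x == y then 2 * 'i * (lim (complex.Im (phi k x w) @[w --> x^']))%:C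
  else phi k x y - (phi k x y)^*.

Definition cross_correlation k (len : R) (J L : nat) (xs : 'I_J -> plane R)
    (zs : 'I_L -> plane R) u (j m : 'I_J) : R[i] :=
  2 * 'i * k%:C * len%:C / L%:R *
    (\sum_(l < L) (u (xs j) (zs l))^* * u (xs m) (zs l))
  - phi_jump k (xs j) (xs m).

Definition indicator_functional k (rB len : R) (J L : nat)
    (xs : 'I_J -> plane R) (zs : 'I_L -> plane R) u (tau : plane R) : R :=
  - k ^+ 2 * complex.Im (((2 * pi) ^+ 2 * rB ^+ 2 / J%:R ^+ 2)%:C *
    \sum_(m < J) \sum_(j < J)
      phi k tau (xs m) * phi k tau (xs j) *
      (cross_correlation k len xs zs u j m)^*).

(* The indicator samples fields at single points, so the L^oo norm of a field is
   the pointwise supremum of its modulus.  For a continuous field this is also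
   the essential supremum for the arc length measures. *)
Definition Linfty_norm (A B : set (plane R)) u : \bar R :=
  ereal_sup [set (Normc.normc (u p.1 p.2))%:E | p in A `*` B].

End Scattering.

(* Main.v *)
(* The fields enter I only through their values at the finitely many points
   (x_j, z_l), so with e bounding |udelta - u| and U bounding |u| at these points,
   conj(u) u changes by at most 2 U e + e^2, and I by a constant multiple of this
   as soon as phi(tau, x_m) is bounded uniformly in tau.  That bound holds because
   the closure of Omega is compact and misses the circle, hence |tau - x_m| stays
   in some [a, b] with a > 0, where both Bessel series are dominated termwise by
   the exponential series of (b / 2)^2. *)

Require Import Defs.
From mathcomp Require Import all_boot all_order all_algebra.
From mathcomp Require Import all_classical all_reals all_analysis.
From mathcomp Require Import complex.
From mathcomp Require Import ring lra.

Import Order.TTheory GRing.Theory Num.Theory.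
Import numFieldNormedType.Exports.

Local Open Scope classical_set_scope.
Local Open Scope ring_scope.

(** * Modulus estimates for complex numbers *)

Section ComplexModulus.
Context {R : rcfType}.
Implicit Types x y : R[i].
Local Open Scope complex_scope.

Lemma normc_ge0 x : 0 <= Normc.normc x.
Proof. by case: x => a b; rewrite /= sqrtr_ge0. Qed.

Lemma normc_conj x : Normc.normc x^* = Normc.normc x.
Proof. by case: x => a b; rewrite /= sqrrN. Qed.

Lemma normr_Im_le_normc x : `|complex.Im x| <= Normc.normc x.
Proof. by case: x => a b /=; rewrite -sqrtr_sqr ler_wsqrtr// lerDr sqr_ge0. Qed.

(** Squaring the right side adds the nonnegative cross term to the squared modulus. This lets the
    two Bessel functions be bounded separately. *)
Lemma normc_le_Re_Im x :
  Normc.normc x <= `|complex.Re x| + `|complex.Im x|.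
Proof.
case: x => a b /=; rewrite -[leRHS]ger0_norm ?addr_ge0// -[leRHS]sqrtr_sqr.
rewrite ler_wsqrtr// sqrrD !real_normK ?num_real//.
by rewrite addrAC lerDl mulrn_wge0// mulr_ge0.
Qed.

Lemma normc_real (r : R) : Normc.normc r%:C = `|r|.
Proof. by rewrite /= expr0n addr0 sqrtr_sqr. Qed.

Lemma normc_sum_le n (F : 'I_n -> R[i]) (B : R) :
  (forall i, Normc.normc (F i) <= B) ->
  Normc.normc (\sum_(i < n) F i) <= n%:R * B.
Proof.
move=> FB; apply: (@le_trans _ _ (\sum_(i < n) Normc.normc (F i))).
  elim/big_ind2: _ => [|a x b y ax by_|//]; first by rewrite Normc.normc0.
  by apply: le_trans (le_normcD _ _) _; exact: lerD.
apply: (le_trans (ler_sum _ (fun i _ => FB i))).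
by rewrite sumr_const card_ord mulr_natl.
Qed.

(** Expanding around [a] and [b], the product of the two errors gives [e ^+ 2] and each of the two
    mixed terms gives [U * e]. *)
Lemma normc_conjM_sub_le (a b a' b' : R[i]) (U e : R) :
  Normc.normc a <= U -> Normc.normc b <= U ->
  Normc.normc (a' - a) <= e -> Normc.normc (b' - b) <= e ->
  Normc.normc (a^* * b - a'^* * b') <= 2 * U * e + e ^+ 2.
Proof.
move=> aU bU ae be.
have -> : a^* * b - a'^* * b' =
    - ((a' - a)^* * (b' - b) + ((a' - a)^* * b + a^* * (b' - b))).
  by rewrite rmorphB/=; ring.
rewrite normcN; apply: le_trans (le_normcD _ _) _.
have -> : 2 * U * e + e ^+ 2 = e * e + (e * U + U * e) by ring.
apply: lerD; first by rewrite Normc.normcM ler_pM ?normc_ge0// normc_conj.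
apply: le_trans (le_normcD _ _) _.
by apply: lerD; rewrite Normc.normcM ler_pM ?normc_ge0// normc_conj.
Qed.

End ComplexModulus.

(** * Bessel series and the Hankel function away from the origin *)

Section HankelBound.
Context {R : realType}.
Implicit Types t a b : R.

(** Comparison with [g] makes [series f] absolutely convergent, so its [limn] is a genuine limit and
    the triangle inequality passes to it. *)
Lemma normr_lim_series_le (f g : R ^nat) :
  cvgn (series g) -> (forall n, `|f n| <= g n) ->
  `|limn (series f)| <= limn (series g).
Proof.
move=> cg fg.
have cf : cvgn [normed series f].
  apply: series_le_cvg cg => // n; first exact: normr_ge0.
  exact: le_trans (normr_ge0 _) (fg n).
apply: le_trans (lim_series_norm cf) _.
exact: lim_series_le.
Qed.

Lemma series_harmonic_le n : series (@harmonic R) n <= n%:R.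
Proof.
rewrite -[n in leRHS]subn0 -sumr_const_nat.
apply: ler_sum_nat => i _.
by rewrite invf_le1// ler1n.
Qed.

Lemma fact_ge_id n : (n <= n`!)%N.
Proof. by case: n => // n; rewrite factS leq_pmulr// fact_gt0. Qed.

(** The weight [w] is 1 for [besselJ0] and a harmonic sum for [besselY0]. It cancels at most one of
    the two factorials, and the other one leaves an exponential series. *)
Lemma bessel_term_le (w t b : R) n : `|t| <= b -> `|w| <= n`!%:R ->
  `|(-1) ^+ n * w * (t / 2) ^+ n.*2 / n`!%:R ^+ 2| <=
  exp_coeff ((b / 2) ^+ 2) n.
Proof.
move=> tb wn.
have n0 : (0 : R) < n`!%:R by rewrite ltr0n fact_gt0.
rewrite !normrM normfV !normrX normrN1 expr1n mul1r (gtr0_norm n0).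
rewrite /exp_coeff/= -exprM mul2n.
apply: (@le_trans _ _ (n`!%:R * (b / 2) ^+ n.*2 / n`!%:R ^+ 2)).
  rewrite ler_wpM2r ?invr_ge0 ?exprn_ge0 ?(ltW n0)//.
  apply: ler_pM; rewrite ?exprn_ge0//.
  have h2 : `|t / 2| <= b / 2 by rewrite normrM normfV normr_nat ler_wpM2r.
  by apply: lerXn2r => //; rewrite nnegrE// (le_trans _ h2).
by rewrite le_eqVlt; apply/orP; left; apply/eqP; field; rewrite gt_eqF.
Qed.

Lemma besselJ0_le t b : `|t| <= b -> `|besselJ0 t| <= expR ((b / 2) ^+ 2).
Proof.
move=> tb; apply: normr_lim_series_le; first exact: is_cvg_series_exp_coeff.
move=> n; rewrite -[(-1) ^+ n]mulr1; apply: bessel_term_le => //.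
by rewrite normr1 ler1n fact_gt0.
Qed.

Lemma besselY0_series_le t b : `|t| <= b ->
  `|limn (series (fun n =>
      (-1) ^+ n * series harmonic n * (t / 2) ^+ n.*2 / n`!%:R ^+ 2))|
  <= expR ((b / 2) ^+ 2).
Proof.
move=> tb; apply: normr_lim_series_le; first exact: is_cvg_series_exp_coeff.
move=> n; apply: bessel_term_le => //.
rewrite ger0_norm; last by apply: sumr_ge0 => i _; exact: harmonic_ge0.
by apply: le_trans (series_harmonic_le n) _; rewrite ler_nat fact_ge_id.
Qed.

Lemma hankel0_bounded a b : 0 < a ->
  exists H : R, forall t, a <= t <= b -> Normc.normc (hankel0 t) <= H.
Proof.
move=> a0; pose E := expR ((b / 2) ^+ 2).
(* By monotonicity [ln (t / 2)] lies between its values at the endpoints; [W] bounds the logarithmic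
   factor of [besselY0]. *)
pose W := `|ln (a / 2)| + `|ln (b / 2)| + `|@euler_gamma R|.
have p0 : 0 <= 2 / pi :> R by rewrite divr_ge0// pi_ge0.
exists (E + 2 / pi * (W * E + E)) => t /andP[at_ tb].
have t0 : 0 < t := lt_le_trans a0 at_.
have tb' : `|t| <= b by rewrite gtr0_norm.
apply: le_trans (normc_le_Re_Im _) _; apply: lerD; first exact: besselJ0_le.
rewrite /= /besselY0 normrM (ger0_norm p0) ler_wpM2l//.
apply: le_trans (ler_normB _ _) _; apply: lerD; last exact: besselY0_series_le.
rewrite normrM ler_pM//; last exact: besselJ0_le.
apply: le_trans (ler_normD _ _) _; rewrite lerD2r.
have l1 : ln (a / 2) <= ln (t / 2).
  by rewrite ler_ln ?posrE ?divr_gt0// ler_wpM2r.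
have l2 : ln (t / 2) <= ln (b / 2).
  by rewrite ler_ln ?posrE ?divr_gt0// ?ler_wpM2r// (lt_le_trans t0).
have := ler_norm (ln (b / 2)); have := ler_norm (- ln (a / 2)).
have := normr_ge0 (ln (a / 2)); have := normr_ge0 (ln (b / 2)).
rewrite normrN ler_norml; lra.
Qed.

End HankelBound.

(** * Euclidean norm, compactness, and a uniform bound on [phi] *)

Section PhiBound.
Context {R : realType}.
Implicit Types (x y c : plane R) (A : set (plane R)).

Lemma enorm_ge0 x : 0 <= enorm x.
Proof. exact: sqrtr_ge0. Qed.

Lemma normr_coord_le_enorm x i : `|x 0 i| <= enorm x.
Proof.
rewrite -sqrtr_sqr ler_wsqrtr// (bigD1 i)//= lerDl.
by apply: sumr_ge0 => j _; exact: sqr_ge0.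
Qed.

Lemma normr_le_enorm x : `|x| <= enorm x.
Proof.
rewrite {1}/Num.norm/= mx_normrE; apply: bigmax_le; first exact: enorm_ge0.
by move=> [i j] _ /=; rewrite ord1 normr_coord_le_enorm.
Qed.

Lemma enorm_eq0 x : enorm x = 0 -> x = 0.
Proof.
move=> x0; apply/rowP => i; rewrite mxE; apply/normr0_eq0/le_anti.
by rewrite normr_ge0 andbT -x0 normr_coord_le_enorm.
Qed.

Lemma continuous_enorm : continuous (@enorm R).
Proof.
move=> x; apply: (@continuous_comp _ _ _ _ Num.sqrt).
  apply: continuous_big x => [|i _ x]; first exact: add_continuous.
  apply: (@continuous_comp _ _ _ (fun x : plane R => x 0 i) (fun r => r ^+ 2)).
    exact: coord_continuous.
  exact: exprn_continuous.
exact: sqrt_continuous.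
Qed.

Lemma closed_sub_disc_compact A c (r : R) :
  closed A -> A `<=` open_disc c r -> compact A.
Proof.
move=> cA Ar; apply: bounded_closed_compact => //.
(* Boundedness is stated in the sup norm, which is at most [enorm]; the radius comes from writing
   [x] as [c + (x - c)]. *)
exists (`|c| + r); split; first by rewrite num_real.
move=> M Mr x /Ar/ltW xr; apply: le_trans (ltW Mr).
rewrite -(subrK c x) [_ + c]addrC; apply: le_trans (ler_normD _ _) _.
by rewrite lerD2l; exact: le_trans (normr_le_enorm _) xr.
Qed.

Lemma phi_bounded (k : R) A y : 0 < k -> compact A -> ~ A y ->
  exists P : R, forall x, A x -> Normc.normc (phi k x y) <= P.
Proof.
(* The extreme value theorem below requires a nonempty set. *)
move=> k0 cA Ay; have [->|/set0P A0] := eqVneq A set0; first by exists 0.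
have cd : {within A, continuous (fun x => enorm (x - y))}.
  apply: continuous_subspaceT => x.
  apply: (@continuous_comp _ _ _ (fun x => x - y) enorm).
    by apply: continuousB => //; exact: cst_continuous.
  exact: continuous_enorm.
have [p /[!inE] Ap pmin] := compact_EVT_min A0 cA cd.
have [q /[!inE] Aq qmax] := compact_EVT_max A0 cA cd.
(* The minimal distance is attained at a point of [A], so its vanishing would put [y] in [A]. *)
have p0 : 0 < enorm (p - y).
  rewrite lt_neqAle enorm_ge0 andbT eq_sym; apply/eqP => /enorm_eq0/subr0_eq py.
  by rewrite -py in Ay.
have [H hH] := hankel0_bounded _ (k * enorm (q - y)) (mulr_gt0 k0 p0).
exists (Normc.normc ('i / 4 : R[i]) * H) => x Ax.
rewrite /phi Normc.normcM ler_wpM2l ?normc_ge0// hH//.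
by rewrite !ler_pM2l// pmin ?qmax ?inE.
Qed.

End PhiBound.

(** * Perturbation of the cross-correlation and of the indicator *)

Section Stability.
Context {R : realType}.
Variables (k rB len : R) (J L : nat).
Variables (xs : 'I_J -> plane R) (zs : 'I_L -> plane R).
Variables (u v : plane R -> plane R -> R[i]) (U e : R).
Hypothesis uU : forall j l, Normc.normc (u (xs j) (zs l)) <= U.
Hypothesis uve : forall j l,
  Normc.normc (v (xs j) (zs l) - u (xs j) (zs l)) <= e.

Let weight : R[i] := 2 * 'i * k%:C%C * len%:C%C / L%:R.

(** The term [phi_jump] does not depend on the field and cancels, also for coinciding points; only
    the sum over sources remains. *)
Lemma cross_correlation_sub_le j m :
  Normc.normc (cross_correlation k len xs zs u j m
    - cross_correlation k len xs zs v j m) <=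
  Normc.normc weight * (L%:R * (2 * U * e + e ^+ 2)).
Proof.
rewrite /cross_correlation opprB addrA subrK -mulrBr -sumrB Normc.normcM.
rewrite ler_wpM2l ?normc_ge0//; apply: normc_sum_le => l.
exact: normc_conjM_sub_le.
Qed.

(** The sampling point enters the estimate only through [P], which is what makes the final constants
    uniform. *)
Lemma indicator_functional_sub_le (P : R) tau :
  (forall m, Normc.normc (phi k tau (xs m)) <= P) ->
  `|indicator_functional k rB len xs zs u tau
    - indicator_functional k rB len xs zs v tau| <=
  k ^+ 2 * (`|(2 * pi) ^+ 2 * rB ^+ 2 / J%:R ^+ 2| *
    (J%:R * (J%:R * (P ^+ 2 *
      (Normc.normc weight * (L%:R * (2 * U * e + e ^+ 2))))))).
Proof.
move=> phiP; rewrite /indicator_functional -mulrBr normrM normrN.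
rewrite (ger0_norm (sqr_ge0 k)) ler_wpM2l ?sqr_ge0// -raddfB -mulrBr.
apply: le_trans (normr_Im_le_normc _) _.
rewrite Normc.normcM normc_real ler_wpM2l//.
rewrite -sumrB; apply: normc_sum_le => m.
rewrite -sumrB; apply: normc_sum_le => j.
rewrite -mulrBr -rmorphB Normc.normcM ler_pM ?normc_ge0//.
  by rewrite Normc.normcM expr2 ler_pM ?normc_ge0.
by rewrite normc_conj cross_correlation_sub_le.
Qed.

End Stability.

Theorem theorem3p2 (R : realType)
    (D : set (plane R)) (hD : obstacle D)
    (k : R) (hk : 0 < k)
    (us : plane R -> plane R -> R[i])
    (hus : forall z, ~ closure D z -> scattered_field D k z (fun x => us x z))
    (c : plane R) (rB : R) (hrB : 0 < rB)
    (hDB : D `<=` open_disc c rB)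
    (sigma : R -> plane R)
    (hsigma : jordan_curve sigma) (hrect : rectifiable sigma)
    (hBSigma : encloses (curve_image sigma) (circle c rB))
    (Omega : set (plane R)) (hOo : open Omega) (hOc : connected Omega)
    (hDO : D `<=` Omega)
    (hOB : closure Omega `<=` open_disc c rB)
    (J L : nat) (hJ : (0 < J)%N) (hL : (0 < L)%N)
    (xs : 'I_J -> plane R) (hxs : forall j, circle c rB (xs j))
    (zs : 'I_L -> plane R) (hzs : forall l, curve_image sigma (zs l)) :
  let u := total_field k us in
  let I (v : plane R -> plane R -> R[i]) (tau : plane R) :=
    indicator_functional k rB (curve_length sigma) xs zs v tau in
  exists M6 M7 : R,
    [/\ 0 < M6, 0 < M7 &
      forall (udelta : plane R -> plane R -> R[i]) (tau : plane R),
        Omega tau ->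
        let N := Linfty_norm (circle c rB) (curve_image sigma)
                   (fun x z => udelta x z - u x z) in
        (`|I u tau - I udelta tau|%:E <= M6%:E * N ^+ 2 + M7%:E * N)%E].
Proof.
move=> u I.
have cO : compact (closure Omega).
  exact: closed_sub_disc_compact (@closed_closure _ _) hOB.
have /choice[Pm PmP] : forall m, exists P : R,
    forall x, closure Omega x -> Normc.normc (phi k x (xs m)) <= P.
  move=> m; apply: phi_bounded => // /hOB; rewrite /open_disc/= hxs.
  by rewrite ltxx.
(* A sum of absolute values dominates each summand, giving one bound for all [m]; [U] below is built
   in the same way. *)
pose P : R := \sum_m `|Pm m|.
have phiP tau m : Omega tau -> Normc.normc (phi k tau (xs m)) <= P.
  move=> /(@subset_closure _ Omega) /PmP/le_trans -> //.
  apply: le_trans (ler_norm _) _.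
  by rewrite /P (bigD1 m)//= lerDl sumr_ge0.
pose U : R := \sum_j \sum_l Normc.normc (u (xs j) (zs l)).
have U0 : 0 <= U by do 2! (apply: sumr_ge0 => ? _); exact: normc_ge0.
have uU j l : Normc.normc (u (xs j) (zs l)) <= U.
  rewrite /U (bigD1 j)//= (bigD1 l)//= -addrA lerDl addr_ge0//.
    by apply: sumr_ge0 => ? _; exact: normc_ge0.
  by do 2! (apply: sumr_ge0 => ? _); exact: normc_ge0.
pose w : R :=
  Normc.normc (2 * 'i * k%:C%C * (curve_length sigma)%:C%C / L%:R : R[i]).
(* [K] collects everything that multiplies [2 * U * e + e ^+ 2] in the stability bound. *)
pose K := k ^+ 2 * (`|(2 * pi) ^+ 2 * rB ^+ 2 / J%:R ^+ 2| *
  (J%:R * (J%:R * (P ^+ 2 * (w * L%:R))))).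
have w0 : 0 <= w := normc_ge0 _.
have K0 : 0 <= K.
  do 4! (apply: mulr_ge0; rewrite ?sqr_ge0//).
  by rewrite mulr_ge0 ?sqr_ge0// mulr_ge0.
have M6_gt0 : 0 < K + 1 by exact: ltr_wpDl.
have M7_gt0 : 0 < K * (2 * U) + 1 by rewrite ltr_wpDl// mulr_ge0// mulr_ge0.
(* Adding 1 keeps the constants positive even if [K] or [U] vanishes. *)
exists (K + 1), (K * (2 * U) + 1); split; [exact: M6_gt0|exact: M7_gt0|].
move=> udelta tau Otau; set N := Linfty_norm _ _ _; cbv zeta.
have dN j l : ((Normc.normc (udelta (xs j) (zs l) - u (xs j) (zs l)))%:E <= N)%E.
  apply: ereal_sup_ubound; exists (xs j, zs l) => //.
  by split; [exact: hxs|exact: hzs].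
(* Since [J] and [L] are positive, some sampled pair exists; this rules out the value [-oo] of a
   supremum over the empty set. *)
have N0 : (0%:E <= N)%E.
  by apply: le_trans (dN (Ordinal hJ) (Ordinal hL)); rewrite lee_fin normc_ge0.
move: dN N0; case: N => [e dN e0|_ _|//].
- rewrite -EFin_expe -!EFinM -EFinD lee_fin.
  rewrite lee_fin in e0.
  have dNe j l : Normc.normc (udelta (xs j) (zs l) - u (xs j) (zs l)) <= e.
    by rewrite -lee_fin.
  apply: le_trans (indicator_functional_sub_le _ _ _ _ _ _ _ _ _ _ _
    uU dNe _ _ (fun m => phiP tau m Otau)) _.
  rewrite -/w.
  (* Regroup by powers of [e]; passing to the enlarged coefficients then uses [0 <= e]. *)
  apply: (@le_trans _ _ (K * e ^+ 2 + K * (2 * U) * e)).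
    by rewrite le_eqVlt; apply/orP; left; apply/eqP; rewrite /K; ring.
  by rewrite lerD// ler_wpM2r ?sqr_ge0// lerDl.
(* For [N = +oo], strict positivity of the constants makes the right side [+oo]; a zero constant
   would give a zero product. *)
- by rewrite expe2 mulyy !gt0_muley ?lte_fin// leey.
Qed.
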